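(* Let $q$ be a prime power, $n>1$ an integer, and let $\mathbf{P}$ be a non-trivial partition of $V_n(q)$. Let $t$ be the minimum of the dimensions of the components of $\mathbf{P}$. Then there exists a positive integer $\alpha$ such that the number of components of $\mathbf{P}$ of dimension $t$ is greater than or equal to $\alpha q+t$.
   Context: $V_n(q)$ denotes the $n$-dimensional vector space over the finite field $\mathbb{F}_q$ with $q$ elements. A partition of $V_n(q)$ is a (finite) set $\mathbf{P}=\{V_1,\dots,V_r\}$ of non-zero subspaces (called components) of $V_n(q)$ such that $\bigcup_{i=1}^r V_i=V_n(q)$ and $V_i\cap V_j=\{0\}$ for $i\neq j$. It is non-trivial if $r\ge 2$. *)

(* Defs.v *)
From mathcomp Require Import all_boot all_order all_algebra finmap.

Set Implicit Arguments.
Unset Strict Implicit.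
Unset Printing Implicit Defensive.

Import GRing.Theory.

Local Open Scope fset_scope.

Section Partition.
Variables (F : finFieldType) (V : vectType F).
Implicit Type P : {fset {vspace V}}.

Definition vspace_partition P : Prop :=
  [/\ forall U, U \in P -> U <> 0%VS,
      forall v : V, exists2 U, U \in P & v \in U
    & forall U W, U \in P -> W \in P -> U <> W -> (U :&: W)%VS = 0%VS].

Definition nontrivial_partition P : Prop :=
  vspace_partition P /\ 2 <= #|` P|.

Definition components_of_dim P (d : nat) : {fset {vspace V}} :=
  [fset U in P | \dim U == d].

Definition is_min_component_dim P (t : nat) : Prop :=
  (exists2 U, U \in P & \dim U = t) /\ (forall U, U \in P -> t <= \dim U).

End Partition.

(* Main.v *)
Require Import Defs.
From mathcomp Require Import all_boot all_order all_algebra finmap.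
From mathcomp Require Import finfield.
From mathcomp Require Import zify.

(** The bound already holds with alpha = 1: if t is the least dimension of a
    component, there are at least q + t components of dimension t.

    Everything rests on a count relative to a hyperplane H of the ambient
    space A of dimension N.  The q^N - q^(N-1) vectors of A outside H are
    shared out among the components that are not contained in H, and such a
    component of dimension d contains q^d - q^(d-1) of them.  Dividing by
    q - 1, the sum of q^(d-1) over these components is q^(N-1)
    ([sum_components_off_hyperplane]).  All terms with d > t are divisible by
    q^t, and so is q^(N-1); hence q divides the number of t-dimensional
    components not contained in H
    ([dvdn_min_components_off_hyperplane]).

    Applied to a hyperplane that does not contain a given t-dimensional
    component, this gives at least q, so at least two, such components.  Take
    two of them, K and L, and a hyperplane H that contains K but not L.  It
    suffices that at least q + t - 1 of the t-dimensional components are not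
    contained in H, as K is one more.  For t = 1 this is the divisibility by
    q, as L is not contained in H.  For t > 1 the traces of the components on
    H partition H into nonzero subspaces of dimension at least t - 1, and the
    traces of dimension exactly t - 1 are those of the t-dimensional
    components not contained in H; induction on t shows that there are at
    least q + (t - 1) of them ([partitions_min_components]). *)

Import GRing.Theory.

Local Open Scope fset_scope.

(** * Hyperplanes of a subspace *)

Section Hyperplanes.
Set Implicit Arguments.
Unset Strict Implicit.
Variables (F : fieldType) (V : vectType F).
Implicit Types (A H U X : {vspace V}) (w : V).

(** Add to [U] a complement of [U + <[w]>] in [A]. *)
Lemma hyperplane_avoiding U A w :
    (U <= A)%VS -> w \in A -> w \notin U ->
  exists H : {vspace V},
    [/\ (U <= H)%VS, (H <= A)%VS, w \notin H & (\dim H).+1 = \dim A].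
Proof.
move=> sUA wA wU.
have w0 : w != 0%R by apply: contraNneq wU => ->; exact: mem0v.
set B := (U + <[w]>)%VS.
have sBA : (B <= A)%VS by rewrite subv_add sUA -memvE.
have dB : \dim B = (\dim U).+1.
  rewrite dimv_disjoint_sum ?dim_vline ?w0 ?addn1 //.
  apply/eqP; rewrite -subv0; apply/subvP => x.
  rewrite memv_cap => /andP[xU /vlineP[k xk]].
  move: xU; rewrite xk rpredZeq (negPf wU) orbF => /eqP->.
  by rewrite scale0r mem0v.
set H := (U + (A :\: B))%VS.
have sHA : (H <= A)%VS by rewrite subv_add sUA diffvSl.
have HwA : (H + <[w]> = A)%VS.
  rewrite -addvA [(_ + <[w]>)%VS]addvC addvA -/B addvC addv_diff.
  exact/addv_idPl.
have dimHle : (\dim H).+1 <= \dim A.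
  have [+ _] := dimv_add_leqif U (A :\: B)%VS.
  have := dimv_cap_compl A B; rewrite (capv_idPr sBA) dB -/H; lia.
have wH : w \notin H.
  apply/negP => wH; have HA : H = A.
    by rewrite -HwA; apply/esym/addv_idPl; rewrite -memvE.
  by rewrite HA ltnn in dimHle.
exists H; split=> //; first exact: addvSl.
have [+ _] := dimv_add_leqif H <[w]>%VS.
rewrite HwA dim_vline w0; lia.
Qed.

(** [X + H] is all of [A], so the dimension formula gives that of the
    intersection. *)
Lemma dim_cap_hyperplane X A H :
    (X <= A)%VS -> (H <= A)%VS -> (\dim H).+1 = \dim A -> ~~ (X <= H)%VS ->
  (\dim (X :&: H)).+1 = \dim X.
Proof.
move=> sXA sHA dH nXH.
have dXH : \dim (X + H) = \dim A.
  apply/eqP; rewrite eqn_leq dimvS ?subv_add ?sXA //= -dH.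
  rewrite (ltn_leqif (dimv_leqif_sup (addvSr X H))).
  by rewrite subv_add negb_and nXH.
have := dimv_sum_cap X H; rewrite dXH -dH; lia.
Qed.

End Hyperplanes.

(** * Partitions of a subspace *)

Section Partition.
Set Implicit Arguments.
Unset Strict Implicit.
Variables (F : finFieldType) (V : vectType F).

(** Subspaces are indexed by a finite type, rather than collected in a set, so
    that the traces on a subspace form a family over the same index type
    and dimension counts before and after can be compared index by index.
    A zero subspace may occur, even repeatedly. *)
Record partitions (A : {vspace V}) (I : finType) (U : I -> {vspace V}) : Prop :=
  Partitions {
    partitions_sub : forall i, (U i <= A)%VS;
    partitions_cover : forall v, v \in A -> exists i, v \in U i;
    partitions_disjoint : forall i j, i != j -> (U i :&: U j = 0)%VS }.

Lemma partitions_cap A (I : finType) (U : I -> {vspace V}) (H : {vspace V}) :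
  partitions A U -> (H <= A)%VS -> partitions H (fun i => U i :&: H)%VS.
Proof.
move=> [sUA cov dis] sHA; split=> [i|v vH|i j /dis Uij]; first exact: capvSr.
  have [i vi] := cov v (subvP sHA _ vH).
  by exists i; rewrite memv_cap vi.
apply/eqP; rewrite -subv0 -Uij; apply: capvS; exact: capvSl.
Qed.

(** * Counting vectors outside a hyperplane *)

Lemma card_vectors (Y : {vspace V}) :
  #|[set v : finvect_type V | v \in Y]| = (#|F| ^ \dim Y)%N.
Proof.
(* V is split so that its vector space structure and the finite type of its
   vectors have syntactically the same carrier. *)
case: V Y => T cT Y; rewrite cardsE.
exact: (@card_vspace F (finvect_type (Vector.Pack cT)) cT Y).
Qed.

Lemma card_setD_cap (X H : {vspace V}) :
    (\dim (X :&: H)).+1 = \dim X ->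
  #|[set v : finvect_type V | (v \in X) && (v \notin H)]|
    = (#|F|.-1 * #|F| ^ (\dim X).-1)%N.
Proof.
move=> dX.
pose vectors (Y : {vspace V}) := [set v : finvect_type V | v \in Y].
have -> : [set v : finvect_type V | (v \in X) && (v \notin H)] =
          vectors X :\: vectors H.
  by apply/setP => v; rewrite !inE andbC.
rewrite cardsD.
have -> : vectors X :&: vectors H = vectors (X :&: H)%VS.
  by apply/setP => v; rewrite !inE; exact/esym/(@memv_cap F V).
by rewrite !card_vectors -dX /= expnS -subn1 mulnBl mul1n.
Qed.

(** The vectors of [A] outside [H] are counted in two ways. A vector outside [H]
    is nonzero, so it lies in exactly one component; the common factor
    [#|F| - 1] is cancelled. *)
Lemma sum_components_off_hyperplane A (I : finType) (U : I -> {vspace V})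
    (H : {vspace V}) :
    partitions A U -> (H <= A)%VS -> (\dim H).+1 = \dim A ->
  (\sum_(i | ~~ (U i <= H)%VS) #|F| ^ (\dim (U i)).-1 = #|F| ^ (\dim A).-1)%N.
Proof.
move=> [sUA cov dis] sHA dH.
have q1 : 0 < #|F|.-1 by rewrite -subn1 subn_gt0 finNzRing_gt1.
apply/eqP; rewrite -(eqn_pmul2l q1); apply/eqP.
rewrite big_distrr /= -(@card_setD_cap A H); last by rewrite (capv_idPr sHA).
pose D i := [set v : finvect_type V | (v \in U i) && (v \notin H)].
have -> : [set v : finvect_type V | (v \in A) && (v \notin H)] = \bigcup_i D i.
  apply/setP => v; rewrite inE; apply/andP/bigcupP => [[vA vH]|[i _]].
    by have [i vi] := cov v vA; exists i; rewrite // inE vi.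
  by rewrite inE => /andP[vi vH]; split=> //; exact: (subvP (sUA i)).
rewrite -sum1_card partition_disjoint_bigcup; last first.
  move=> i j /dis Uij; rewrite -setI_eq0; apply/eqP/setP => v; rewrite !inE.
  apply/negP => /andP[/andP[vi vH] /andP[vj _]].
  have : v \in (U i :&: U j)%VS by rewrite (@memv_cap F V) vi.
  rewrite Uij (@memv0 F V) => /eqP v0.
  by rewrite v0 (@mem0v F V) in vH.
rewrite [RHS](bigID (fun i => (U i <= H)%VS)) /= [X in (X + _)%N]big1 ?add0n.
  apply: eq_bigr => i nUH; rewrite sum1_card card_setD_cap //.
  exact: (dim_cap_hyperplane (sUA i) sHA dH).
move=> i sUH; apply: big_pred0 => v; rewrite inE.
by apply/negP => /andP[vi /negP[]]; exact: (subvP sUH).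
Qed.

(** In the previous count the components of dimension [t.+1] contribute
    [#|F| ^ t] each, and everything else is [0] modulo [#|F| ^ t.+1]. *)
Lemma dvdn_min_components_off_hyperplane A (I : finType) (U : I -> {vspace V})
    (H : {vspace V}) t :
    partitions A U -> (H <= A)%VS -> (\dim H).+1 = \dim A ->
    (forall i, t < \dim (U i)) -> t.+1 < \dim A ->
  #|F| %| #|[set i | (\dim (U i) == t.+1) && ~~ (U i <= H)%VS]|.
Proof.
move=> pU sHA dH minU tA.
have q0 : 0 < #|F| by rewrite ltnW ?finNzRing_gt1.
have := sum_components_off_hyperplane pU sHA dH.
rewrite (bigID (fun i => \dim (U i) == t.+1)) /= => E.
rewrite -(@dvdn_pmul2l (#|F| ^ t)) ?expn_gt0 ?q0 // -expnSr.
have : #|F| ^ t.+1 %| #|F| ^ (\dim A).-1 by apply: dvdn_exp2l; lia.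
rewrite -{}E dvdn_addl; last first.
  apply: dvdn_sum => i /andP[_ dUi]; apply: dvdn_exp2l.
  by have := minU i; move/eqP: dUi; lia.
rewrite (eq_bigr (fun=> #|F| ^ t)%N); last by move=> i /andP[_ /eqP->].
rewrite sum_nat_const mulnC; congr (_ %| _ * _).
by apply: eq_card => i; rewrite !inE andbC.
Qed.

(** * The number of components of least dimension *)

(** A nonzero vector of [U l] is not in [U k], as the two meet trivially; a
    hyperplane through [U k] can avoid it. *)
Lemma hyperplane_separating_components A (I : finType) (U : I -> {vspace V})
    k l :
    partitions A U -> k != l -> U l != 0%VS ->
  exists H : {vspace V},
    [/\ (U k <= H)%VS, (H <= A)%VS, (\dim H).+1 = \dim A & ~~ (U l <= H)%VS].
Proof.
move=> [sUA _ dis] kl Ul0; have wl := memv_pick (U l).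
have wk : vpick (U l) \notin U k.
  apply: contra Ul0 => wk; rewrite -vpick0 -memv0 -(dis _ _ kl).
  by rewrite memv_cap wk wl.
have [H [? ? wH ?]] :=
  hyperplane_avoiding (sUA k) (subvP (sUA l) _ wl) wk.
by exists H; split=> //; apply: contra wH => /subvP; apply.
Qed.

(** A hyperplane that does not contain a given least-dimensional component
    leaves a positive multiple of [#|F|], hence at least two of them,
    outside. *)
Lemma two_min_components A (I : finType) (U : I -> {vspace V}) t :
    partitions A U -> (forall i, t < \dim (U i)) ->
    (exists i, \dim (U i) = t.+1) -> 1 < #|I| -> t.+1 < \dim A ->
  1 < #|[set i | \dim (U i) == t.+1]|.
Proof.
move=> pU minU [i di] I2 tA.
have [j ji] : exists j, j != i.
  move: I2; rewrite -cardsT (cardsD1 i) inE ltnS => /card_gt0P[j].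
  by rewrite !inE andbT; exists j.
have [|H [_ sHA dH nUH]] := hyperplane_separating_components pU ji.
  by rewrite -dimv_eq0 di.
have := dvdn_min_components_off_hyperplane pU sHA dH minU tA.
set S := [set _ | _] => qS.
have S0 : 0 < #|S| by apply/card_gt0P; exists i; rewrite inE di eqxx.
apply: leq_trans (finNzRing_gt1 F) (leq_trans (dvdn_leq S0 qS) _).
by apply/subset_leq_card/subsetP => k; rewrite !inE => /andP[].
Qed.

Lemma partitions_dim_gt A (I : finType) (U : I -> {vspace V}) t :
    partitions A U -> (forall i, t < \dim (U i)) -> 1 < #|I| ->
  t.+1 < \dim A.
Proof.
move=> [sUA _ dis] minU; rewrite -cardsT => /card_gt1P[i [j [_ _ ij]]].
have : \dim (U i + U j) <= \dim A by rewrite dimvS // subv_add !sUA.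
rewrite dimv_disjoint_sum ?dis //; have := minU i; have := minU j; lia.
Qed.

(** The induction is on the least dimension: the components are cut by a
    hyperplane [H] that contains one least-dimensional component [U k], but
    not another one [U l]. *)
Lemma partitions_min_components A (I : finType) (U : I -> {vspace V}) t :
    partitions A U -> (forall i, t < \dim (U i)) ->
    (exists i, \dim (U i) = t.+1) -> 1 < #|I| ->
  #|F| + t.+1 <= #|[set i | \dim (U i) == t.+1]|.
Proof.
elim: t A U => [|t IHt] A U pU minU exU I2.
all: have tA := partitions_dim_gt pU minU I2.
all: have /card_gt1P[k [l []]] := two_min_components pU minU exU I2 tA.
all: rewrite !inE => /eqP dk /eqP dl kl.
all: have [|H [kH sHA dH nlH]] := hyperplane_separating_components pU kl;
  first by rewrite -dimv_eq0 dl.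
all: rewrite (cardsD1 k) inE dk eqxx addnS.
(* In both cases U k is set aside; the other components that are counted lie
   off H. *)
- rewrite addn0 add1n ltnS.
  have := dvdn_min_components_off_hyperplane pU sHA dH minU tA.
  set S := [set _ | _] => qS.
  have S0 : 0 < #|S| by apply/card_gt0P; exists l; rewrite inE dl eqxx.
  apply: leq_trans (dvdn_leq S0 qS) _.
  apply/subset_leq_card/subsetP => i; rewrite !inE => /andP[-> iH].
  by rewrite andbT; apply: contraNneq iH => ->.
- rewrite add1n ltnS.
  have dimUH i : ~~ (U i <= H)%VS -> (\dim (U i :&: H)).+1 = \dim (U i).
    have [sUA _ _] := pU.
    exact: (dim_cap_hyperplane (sUA i) sHA dH).
  have minUH i : t < \dim (U i :&: H).
    have [iH|/dimUH E] := boolP (U i <= H)%VS.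
      by rewrite (capv_idPl iH) ltnW.
    by rewrite -ltnS E.
  have exUH : exists i, \dim (U i :&: H) = t.+1.
    by exists l; apply/succn_inj; rewrite dimUH.
  have := IHt H (fun i => U i :&: H)%VS (partitions_cap pU sHA) minUH exUH I2.
  move=> /leq_trans; apply.
  apply/subset_leq_card/subsetP => i; rewrite !inE => /eqP dUH.
  (* A component inside H keeps its dimension, which is at least t.+2. *)
  have iH : ~~ (U i <= H)%VS.
    by apply/negP => /capv_idPl E; have := minU i; rewrite -E dUH ltnn.
  by rewrite -dimUH // dUH eqxx andbT; apply: contraNneq iH => ->.
Qed.

End Partition.

Theorem theorem3p3 (q n : nat) (F : finFieldType) (V : vectType F)
    (P : {fset {vspace V}}) (t : nat)
    (hq : #|F| = q) (hn : 1 < n) (hV : \dim {:V} = n)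
    (hP : nontrivial_partition P) (ht : is_min_component_dim P t) :
  exists alpha : nat,
    0 < alpha /\ alpha * q + t <= #|` components_of_dim P t|.
Proof.
exists 1; split=> //; rewrite mul1n -{}hq.
have [[nz cov dis] P2] := hP; have [[W WP dW] minP] := ht.
case: t => [|t] in ht dW minP *.
  by case: (nz W WP); apply/eqP; rewrite -dimv_eq0 dW.
have pU : partitions (fullv : {vspace V}) (fun i : P => val i).
  split=> [i|v _|i j ij]; first exact: subvf.
    by have [U UP vU] := cov v; exists [` UP].
  apply: dis; [exact: fsvalP | exact: fsvalP | move/val_inj].
  by apply/eqP.
have P2' : 1 < #|{: P}| by rewrite -cardfE.
have := partitions_min_components (t := t) pU _ _ P2'.
have -> : #|` components_of_dim P t.+1| = #|[set i : P | \dim (val i) == t.+1]|.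
  have -> : components_of_dim P t.+1 =
            [fset val i | i in [set i : P | \dim (val i) == t.+1]].
    apply/fsetP => U; rewrite !inE; apply/andP/imfsetP => [[UP dU]|[i]].
      by exists [` UP]; rewrite ?inE.
    by rewrite !inE => di ->; split=> //; exact: fsvalP.
  by rewrite card_imfset ?cardE //; exact: val_inj.
apply; first by move=> i; apply: minP; exact: fsvalP.
by exists [` WP].
Qed.
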